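(* Let $\Sigma$ be a finite alphabet with $|\Sigma|=q$ and let $m,n\ge 1$. Then (1) there are exactly $q^{\lceil mn/2\rceil}$ distinct 2D palindromes of size $(m,n)$ over $\Sigma$, and (2) there are exactly $q^{\lceil m/2\rceil\lceil n/2\rceil}$ distinct HV-palindromes of size $(m,n)$ over $\Sigma$.
   Context: A 2D word of size $(m,n)$ over $\Sigma$ is an $m\times n$ array $w=[w_{i,j}]$ with entries in $\Sigma$; its rows and columns are 1D words. A 1D word is a palindrome if it equals its reversal. The reverse of $w$ is $w^R=[w_{m-i+1,\,n-j+1}]_{i,j}$; $w$ is a 2D palindrome if $w=w^R$, and an HV-palindrome if each of its rows and each of its columns is a 1D palindrome. *)

(* Defs.v *)
From mathcomp Require Import all_boot all_algebra.

Set Implicit Arguments.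
Unset Strict Implicit.
Unset Printing Implicit Defensive.

Definition palindrome (T : eqType) (s : seq T) : bool := s == rev s.

(* A 2D word of size (m, n) over T is a matrix 'M[T]_(m, n); no algebraic
   structure on T is involved. *)

Definition row_word (T : Type) (m n : nat) (w : 'M[T]_(m, n)) (i : 'I_m) :
  seq T := [seq w i j | j <- enum 'I_n].

Definition col_word (T : Type) (m n : nat) (w : 'M[T]_(m, n)) (j : 'I_n) :
  seq T := [seq w i j | i <- enum 'I_m].

(* Indices are 0-based: [rev_ord i] is [m - i.+1], which corresponds to
   m - i + 1 for 1-based indices. *)
Definition reverse2D (T : Type) (m n : nat) (w : 'M[T]_(m, n)) :
  'M[T]_(m, n) := (\matrix_(i, j) w (rev_ord i) (rev_ord j))%R.

Definition palindrome2D (T : eqType) (m n : nat) (w : 'M[T]_(m, n)) : bool :=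
  w == reverse2D w.

Definition HV_palindrome (T : eqType) (m n : nat) (w : 'M[T]_(m, n)) : bool :=
  [forall i, palindrome (row_word w i)] &&
  [forall j, palindrome (col_word w j)].

(* Main.v *)
Require Import Defs.
From mathcomp Require Import all_boot all_algebra.
From mathcomp Require Import zify.

Set Implicit Arguments.
Unset Strict Implicit.
Unset Printing Implicit Defensive.

(** A word satisfying either symmetry is a function invariant under a retraction
    of its index set, and is freely determined by its values on the fixed points
    of that retraction.  For 2D palindromes, flattening the array row by row
    turns the reversal into the 1D reversal of a word of length [m * n], whose
    first half is free; for HV-palindromes the retraction is the product of the
    two 1D retractions, so the top left quadrant is free. *)

(** Invariance makes a function the composite of [r] with its own restriction to the fixed points of
    [r]. Conversely, since [r] lands in its fixed points, any function on them extends in this way.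
    The bijection [ev] carries the count over to [W]. *)
Lemma card_retract_invariant (I T W : finType) (ev : W -> {ffun I -> T})
    (r : I -> I) :
  bijective ev -> (forall i, r (r i) = r i) ->
  #|[set w | [forall i, ev w (r i) == ev w i]]| = #|T| ^ #|[set i | r i == i]|.
Proof.
move=> ev_bij rK.
pose A := [set f : {ffun I -> T} | [forall i, f (r i) == f i]].
have -> : [set w | [forall i, ev w (r i) == ev w i]] = ev @^-1: A.
  by apply/setP=> w; rewrite !inE.
rewrite on_card_preimset; last exact: onW_bij.
have rP i : r (r i) == r i by rewrite rK.
pose ext (g : {ffun {i | r i == i} -> T}) : {ffun I -> T} :=
  [ffun i => g (exist _ (r i) (rP i))].
have -> : A = ext @: setT.
  apply/setP=> f; rewrite inE; apply/forallP/imsetP => [fr | [g _ ->] i].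
    exists [ffun u => f (val u)] => //; apply/ffunP=> i.
    by rewrite !ffunE SubK (eqP (fr i)).
  by rewrite !ffunE; apply/eqP; congr (g _); apply: val_inj; rewrite !SubK rK.
rewrite card_imset => [|g h eq_gh].
  by rewrite cardsT card_ffun card_sig; congr (_ ^ _); rewrite cardsE.
(* At a fixed point [u] the extension of [g] takes the value [g u], so it determines [g]. *)
apply/ffunP=> u; have /ffunP/(_ (val u)) := eq_gh; rewrite !ffunE.
suff -> : exist _ (r (val u)) (rP (val u)) = u by [].
by apply: val_inj; rewrite /= (eqP (valP u)).
Qed.

Section Fold.

Variables (I : eqType) (key : I -> nat) (s : I -> I).
Hypotheses (key_inj : injective key) (sK : involutive s).

(** The representative of smaller key in the orbit of [i] under [s]; this turns an involution into a
    retraction. *)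
Definition fold i := if key i <= key (s i) then i else s i.

Lemma fold_fixE i : (fold i == i) = (key i <= key (s i)).
Proof.
rewrite /fold; case: leqP => [|lt_si]; first by rewrite eqxx.
by apply/eqP=> eq_si; rewrite eq_si ltnn in lt_si.
Qed.

Lemma foldK i : fold (fold i) = fold i.
Proof.
by apply/eqP; rewrite fold_fixE /fold; case: (leqP (key i)) => //; rewrite sK => /ltnW.
Qed.

(** Both indices lie in the same orbit, and a tie between keys forces [s i = i] by injectivity. *)
Lemma fold_s i : fold (s i) = fold i.
Proof. by rewrite /fold sK; case: ltngtP => // /key_inj. Qed.

Lemma fold_invariantP (T : Type) (f : I -> T) :
  (forall i, f (fold i) = f i) <-> (forall i, f (s i) = f i).
Proof.
split=> f_inv i; first by rewrite -f_inv fold_s.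
by rewrite /fold; case: ifP.
Qed.

End Fold.

(** The condition [i <= n - i.+1] amounts to [2 * i < n]; for odd [n] the middle index is included,
    hence the rounding up. *)
Lemma card_ord_le_rev n : #|[set i : 'I_n | i <= rev_ord i]| = uphalf n.
Proof.
have le_hn : uphalf n <= n by lia.
have -> : [set i : 'I_n | i <= rev_ord i] =
          [set widen_ord le_hn k | k : 'I_(uphalf n)].
  apply/setP=> i; rewrite inE; have lt_in := ltn_ord i.
  apply/idP/imsetP => /= [le_i | [k _ ->] /=].
    have lt_ih : i < uphalf n by lia.
    by exists (Ordinal lt_ih) => //; apply: val_inj.
  by have := ltn_ord k; lia.
by rewrite card_imset ?card_ord // => k l /(congr1 val) /= /val_inj.
Qed.

Lemma rev_enum_ord n : rev (enum 'I_n) = [seq rev_ord i | i <- enum 'I_n].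
Proof.
(* Passing to natural numbers provides the default [0] for [nth], as ['I_n] may be empty. *)
apply: (inj_map (@ord_inj n)); rewrite map_rev -(map_comp _ (@rev_ord n)).
apply: (@eq_from_nth _ 0) => [|k]; first by rewrite size_rev !size_map.
rewrite size_rev size_map size_enum_ord => lt_kn.
pose i0 := Ordinal lt_kn; have lt_rn : n - k.+1 < n := rev_ord_proof i0.
rewrite nth_rev size_map size_enum_ord // (nth_map i0) ?size_enum_ord //.
by rewrite (nth_map i0) ?size_enum_ord //= !nth_enum_ord.
Qed.

Lemma palindrome_enumP (T : eqType) n (f : 'I_n -> T) :
  reflect (forall i, f (rev_ord i) = f i) (palindrome [seq f i | i <- enum 'I_n]).
Proof.
rewrite /palindrome -map_rev rev_enum_ord -(map_comp _ (@rev_ord n)).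
apply: (iffP eqP) => [/eq_in_map eq_f i | eq_f].
  by rewrite [RHS]eq_f ?mem_enum.
by apply/eq_in_map=> i _ /=; rewrite eq_f.
Qed.

Lemma flatten_ord_proof m n (p : 'I_m * 'I_n) : p.1 * n + p.2 < m * n.
Proof. by case: p => [[i lt_im] [j lt_jn]] /=; nia. Qed.

Definition flatten_ord m n (p : 'I_m * 'I_n) : 'I_(m * n) :=
  Ordinal (flatten_ord_proof p).

Lemma flatten_ord_inj m n : injective (@flatten_ord m n).
Proof.
move=> [i j] [k l] /(congr1 val) /= eq_ij; have lt_jn := ltn_ord j.
have n_gt0 : 0 < n by apply: leq_ltn_trans lt_jn.
have eq_ik : i = k :> nat.
  have /(congr1 (divn^~ n)) := eq_ij.
  by rewrite !divnMDl // !divn_small ?ltn_ord // !addn0.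
by congr pair; apply: val_inj => //; move: eq_ij; rewrite eq_ik => /addnI.
Qed.

Definition rev_ord2 m n (p : 'I_m * 'I_n) := (rev_ord p.1, rev_ord p.2).

Lemma rev_ord2K m n : involutive (@rev_ord2 m n).
Proof. by case=> i j; rewrite /rev_ord2 !rev_ordK. Qed.

(** With 0-based indices, [(m - 1 - i) * n + (n - 1 - j) = m * n - 1 - (i * n + j)]. *)
Lemma flatten_ord_rev m n (p : 'I_m * 'I_n) :
  flatten_ord (rev_ord2 p) = rev_ord (flatten_ord p).
Proof.
by apply: val_inj; case: p => [[i lt_im] [j lt_jn]] /=; nia.
Qed.

Definition ffun_of_word (T : Type) m n (w : 'M[T]_(m, n)) :
  {ffun 'I_m * 'I_n -> T} := [ffun p => w p.1 p.2].

Lemma ffun_of_word_bij (T : Type) m n : bijective (@ffun_of_word T m n).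
Proof.
exists (fun f : {ffun _ -> T} => \matrix_(i, j) f (i, j))%R => [w | f].
  by apply/matrixP=> i j; rewrite mxE ffunE.
by apply/ffunP=> -[i j]; rewrite ffunE mxE.
Qed.

Lemma card_palindrome2D (T : finType) m n :
  #|[set w : 'M[T]_(m, n) | palindrome2D w]| = #|T| ^ uphalf (m * n).
Proof.
pose key := val \o @flatten_ord m n.
have key_inj : injective key := inj_comp val_inj (@flatten_ord_inj m n).
have sK := @rev_ord2K m n.
pose r := fold key (@rev_ord2 m n).
have -> : [set w : 'M[T]_(m, n) | palindrome2D w] =
          [set w | [forall p, ffun_of_word w (r p) == ffun_of_word w p]].
  apply/setP=> w; rewrite !inE.
  apply/eqP/forallP => [eq_w p | w_inv].
    apply/eqP; move: p; apply/(fold_invariantP key_inj sK) => p.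
    by rewrite !ffunE [in RHS]eq_w mxE.
  apply/matrixP=> i j; rewrite mxE.
  have := (fold_invariantP key_inj sK (ffun_of_word w)).1.
  by move/(_ (fun p => eqP (w_inv p)))/(_ (i, j)); rewrite !ffunE.
rewrite card_retract_invariant; [|exact: ffun_of_word_bij|exact: foldK].
congr (_ ^ _).
have -> : [set p | r p == p] = @flatten_ord m n @^-1: [set k : 'I_(m * n) | k <= rev_ord k].
  by apply/setP=> p; rewrite !inE fold_fixE -flatten_ord_rev.
rewrite on_card_preimset ?card_ord_le_rev //; apply: onW_bij.
(* An injection between two sets of [m * n] elements is bijective. *)
by apply: inj_card_bij; [apply: flatten_ord_inj | rewrite card_prod !card_ord].
Qed.

Lemma card_HV_palindrome (T : finType) m n :
  #|[set w : 'M[T]_(m, n) | HV_palindrome w]| = #|T| ^ (uphalf m * uphalf n).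
Proof.
pose r1 k := fold val (@rev_ord k).
have r1P k S (f : 'I_k -> S) :=
  fold_invariantP (@val_inj _ _ 'I_k) rev_ordK f.
pose r (p : 'I_m * 'I_n) := (r1 m p.1, r1 n p.2).
have r1K k i : r1 k (r1 k i) = r1 k i by apply: foldK; apply: rev_ordK.
have -> : [set w : 'M[T]_(m, n) | HV_palindrome w] =
          [set w | [forall p, ffun_of_word w (r p) == ffun_of_word w p]].
  apply/setP=> w; rewrite !inE.
  apply/andP/forallP => [[/forallP rowP /forallP colP] [i j] | w_inv].
    (* Unfolding the column index within row [r1 m i], then the row index within column [j], leads
       to [w i j]. *)
    have row_inv := (r1P n _ (w (r1 m i))).2 (palindrome_enumP _ (rowP _)).
    have col_inv := (r1P m _ (w^~ j)).2 (palindrome_enumP _ (colP j)).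
    by rewrite !ffunE /= row_inv col_inv.
  have {}w_inv i j : w (r1 m i) (r1 n j) = w i j.
    by have /eqP := w_inv (i, j); rewrite !ffunE.
  (* Folding [l] beforehand does not change the folded pair of indices, so both entries equal the
     one at that pair. *)
  split; apply/forallP=> k; apply/palindrome_enumP/r1P=> l;
    by rewrite -[LHS]w_inv r1K w_inv.
rewrite card_retract_invariant; first last.
- by move=> p; rewrite /r !r1K.
- exact: ffun_of_word_bij.
congr (_ ^ _).
have -> : [set p | r p == p] =
    setX [set i : 'I_m | i <= rev_ord i] [set j : 'I_n | j <= rev_ord j].
  by apply/setP=> -[i j]; rewrite !inE xpair_eqE !fold_fixE.
by rewrite cardsX !card_ord_le_rev.
Qed.

Unset Implicit Arguments.

Theorem theorem4p1 (Sigma : finType) (q m n : nat)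
    (hq : #|Sigma| = q) (hm : 0 < m) (hn : 0 < n) :
  #|[set w : 'M[Sigma]_(m, n) | palindrome2D w]| = q ^ uphalf (m * n) /\
  #|[set w : 'M[Sigma]_(m, n) | HV_palindrome w]| =
    q ^ (uphalf m * uphalf n).
Proof. by rewrite -hq card_palindrome2D card_HV_palindrome. Qed.
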